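(* Let $L(\mathrm{CFG})$ be the class of posets isomorphic to the configuration space of some convergent Chip Firing Game, and $L(\mathrm{ASM})$ the class of posets isomorphic to the configuration space of some convergent Abelian Sandpile Model. Then $L(\mathrm{ASM})\subsetneq L(\mathrm{CFG})$.
   Context: A Chip Firing Game (CFG) is played on a finite directed multigraph with an initial configuration $\sigma_0:V\to\mathbb{N}$ of chips. A vertex $v$ with at least one outgoing edge and at least $d^+(v)$ chips may be fired, sending one chip along each outgoing edge. An Abelian Sandpile Model (ASM) is the same game played on a finite undirected multigraph with a distinguished vertex $\bot$ (the sink) that is never fired. A vertex $v\neq\bot$ holding at least as many chips as its degree may be fired, sending one chip along each incident edge. For either game, the configuration space is the set of configurations reachable from the initial configuration, ordered by reachability. A game is convergent if it reaches a final configuration in which no firing is possible. *)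

(* Defs.v *)
From mathcomp Require Import all_boot all_order.
From Stdlib Require Import Relation_Operators.

Set Implicit Arguments.
Unset Strict Implicit.
Unset Printing Implicit Defensive.

Definition config (V : finType) := {ffun V -> nat}.

(* A multigraph on V is given by its multiplicities: m v w is the number of
   edges from v to w.  Loops are allowed; an undirected multigraph is a
   symmetric m, a loop being one incident edge, so that in both cases the
   number of chips leaving a fired vertex is deg m v. *)
Definition deg (V : finType) (m : V -> V -> nat) (v : V) : nat :=
  \sum_(w : V) m v w.

(* Both games only fire v when deg m v <= c v, so the subtraction never
   truncates. *)
Definition fire (V : finType) (m : V -> V -> nat) (c : config V) (v : V) :
    config V :=
  [ffun w => c w - (if w == v then deg m v else 0) + m v w].

Definition cfg_firable (V : finType) (m : V -> V -> nat)
    (c : config V) (v : V) : bool :=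
  (0 < deg m v) && (deg m v <= c v).

Definition asm_firable (V : finType) (m : V -> V -> nat) (bot : V)
    (c : config V) (v : V) : bool :=
  (v != bot) && (deg m v <= c v).

Section Game.

Variables (V : finType) (m : V -> V -> nat) (firable : config V -> V -> bool).

Definition step (c c' : config V) : Prop :=
  exists2 v, firable c v & c' = fire m c v.

Definition reachable : config V -> config V -> Prop := clos_refl_trans _ step.

Definition convergent (c0 : config V) : Prop :=
  exists2 c, reachable c0 c & forall v, ~~ firable c v.

(* f is an isomorphism from P onto the set of configurations reachable from
   c0, ordered by reachability with c0 at the bottom. *)
Definition isom_config_space (d : Order.disp_t) (P : porderType d)
    (c0 : config V) : Prop :=
  exists f : P -> config V,
    [/\ injective f,
        forall c, reachable c0 c <-> exists x, f x = c
      & forall x y, (x <= y)%O <-> reachable (f x) (f y)].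

End Game.

Definition L_CFG (d : Order.disp_t) (P : porderType d) : Prop :=
  exists (V : finType) (m : V -> V -> nat) (c0 : config V),
    convergent m (cfg_firable m) c0 /\
    isom_config_space m (cfg_firable m) P c0.

Definition L_ASM (d : Order.disp_t) (P : porderType d) : Prop :=
  exists (V : finType) (m : V -> V -> nat) (bot : V) (c0 : config V),
    [/\ forall u v, m u v = m v u,
        convergent m (asm_firable m bot) c0
      & isom_config_space m (asm_firable m bot) P c0].

(* Main.v *)
(* Deleting the edges that leave the sink turns an ASM into a CFG with the same
   legal moves.

   For the strictness, let x0, x1, x2 be firable from the start, and let a_i
   become firable once x_i or a_(i+1) (indices mod 3) has been fired; this is a
   CFG.  In a convergent game the multiset of vertices still to be fired is
   determined by the configuration, so that covers in the configuration space are
   exactly single firings, and opposite sides of a square are firings of the same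
   vertex.  Hence in an ASM with the same configuration space, a_0, a_1, a_2
   correspond to three vertices A_0, A_1, A_2.  After x_(i+1) and x_(i+2),
   firing a_(i+1) enables a_i while firing a_(i+2) does not, so A_i has more
   edges from A_(i+1) than from A_(i+2).  For symmetric multiplicities these
   three inequalities form a cycle. *)

Require Import Defs.
From HB Require Import structures.
From mathcomp Require Import all_boot all_order.
From mathcomp Require Import zify boolp.
From Stdlib Require Import Relation_Operators Operators_Properties.

Set Implicit Arguments.
Unset Strict Implicit.
Unset Printing Implicit Defensive.

(** * Abelian property of threshold games *)

(** Covers both games at once: a firable vertex can pay its degree, and firability is monotone in
    the vertex's own chips, so receiving chips never disables it. *)
Definition threshold_rule (V : finType) (m : V -> V -> nat)
    (firable : config V -> V -> bool) : Prop :=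
  (forall (c : config V) v, firable c v -> deg m v <= c v) /\
  (forall (c c' : config V) v, c v <= c' v -> firable c v -> firable c' v).

Lemma cfg_threshold_rule (V : finType) (m : V -> V -> nat) :
  threshold_rule m (cfg_firable m).
Proof.
split=> [c v /andP[] //|c c' v le_cc' /andP[m0 le_mc]].
by rewrite /cfg_firable m0 (leq_trans le_mc).
Qed.

Lemma asm_threshold_rule (V : finType) (m : V -> V -> nat) (bot : V) :
  threshold_rule m (asm_firable m bot).
Proof.
split=> [c v /andP[] //|c c' v le_cc' /andP[nbot le_mc]].
by rewrite /asm_firable nbot (leq_trans le_mc).
Qed.

Lemma fire_other (V : finType) (m : V -> V -> nat) (c : config V) (v w : V) :
  w != v -> fire m c v w = c w + m v w.
Proof. by move=> /negbTE nwv; rewrite ffunE nwv subn0. Qed.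

Section Settling.

Variables (V : finType) (m : V -> V -> nat) (firable : config V -> V -> bool).
Hypothesis rule : threshold_rule m firable.
Implicit Types (c d : config V) (s t : seq V).

Lemma firable_persists c u v :
  v != u -> firable c v -> firable (fire m c u) v.
Proof. by move=> nvu; apply: rule.2; rewrite fire_other // leq_addr. Qed.

Lemma fireC c u v : firable c u -> firable c v ->
  fire m (fire m c u) v = fire m (fire m c v) u.
Proof.
move=> /rule.1 leu /rule.1 lev; apply/ffunP => w; rewrite !ffunE.
case: (eqVneq w u) (eqVneq w v) => [->|_] [e|_] //; last by lia.
- by rewrite -e.
- by lia.
- by rewrite e; lia.
Qed.

(** Up to permutation, [s] is an invariant of [c]: the multiset of vertices still to be fired. *)
Fixpoint settles c s : Prop :=
  if s is v :: s' then firable c v /\ settles (fire m c v) s'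
  else forall v, ~~ firable c v.

(** A firable [v] stays firable until fired, so it occurs in [s]; its first occurrence commutes past
    the earlier firings to the front. *)
Lemma settles_fire c s v : settles c s -> firable c v ->
  exists2 s', settles (fire m c v) s' & perm_eq s (v :: s').
Proof.
elim: s c => [|u s IHs] c /=; first by move=> stable /(negP (stable v)).
move=> [fu settled] fv.
have [->|nuv] := eqVneq v u; first by exists s.
have [s' settled' eq_s] := IHs _ settled (firable_persists nuv fv).
exists (u :: s') => [|/=].
  by split; [apply: firable_persists; rewrite // eq_sym | rewrite fireC].
rewrite -(perm_cons u) in eq_s.
by rewrite (perm_trans eq_s) // (perm_catCA [:: u] [:: v]).
Qed.

Lemma settles_perm c s t : settles c s -> settles c t -> perm_eq s t.
Proof.
elim: s c t => [|v s IHs] c t /=.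
  by case: t => [|u t] //= stable [/(negP (stable u))].
move=> [fv settled] /settles_fire/(_ fv)[t' settled' /permPr ->].
by rewrite perm_cons (IHs _ _ settled settled').
Qed.

(** The length of the remaining play is a rank that drops strictly along nontrivial reachability;
    antisymmetry and the cover property rest on it. *)
Lemma settles_reachable c d s : reachable m firable c d -> settles c s ->
  exists2 t, settles d t & (d = c /\ t = s) \/ size t < size s.
Proof.
move=> cd; elim: cd s => {c d} [c d [v fv ->]|c|c d e _ IH1 _ IH2] s.
- move=> /settles_fire/(_ fv)[t settled /perm_size eq_t].
  by exists t => //; right; rewrite eq_t /=.
- by exists s => //; left.
- move=> /IH1[t /IH2[u settled eu] et]; exists u => //.
  case: et eu => [[-> ->]|lt_ts] [[-> ->]|lt_ut]; auto.
  by right; apply: ltn_trans lt_ts.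
Qed.

Lemma convergent_settles c : convergent m firable c -> exists s, settles c s.
Proof.
case=> d cd; have {cd} := clos_rt_rt1n _ _ _ _ cd.
elim=> {c d} [c|c d e [v fv ->] _ IH] stable; first by exists [::].
by have [s settled] := IH stable; exists (v :: s).
Qed.

Lemma reachable_anti c d s : settles c s ->
  reachable m firable c d -> reachable m firable d c -> c = d.
Proof.
move=> settled /settles_reachable/(_ settled)[t settled' [[->]//|lt_ts]].
move=> /settles_reachable/(_ settled')[u settled'' [[->]//|lt_ut]].
have eq_su := perm_size (settles_perm settled settled'').
by have := ltn_trans lt_ut lt_ts; rewrite eq_su ltnn.
Qed.

Lemma fire_inj c s u v : settles c s -> firable c u -> firable c v ->
  fire m c u = fire m c v -> u = v.
Proof.
move=> settled fu fv eq_uv.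
have [s1 settled1 eq1] := settles_fire settled fu.
have [s2 settled2 eq2] := settles_fire settled fv.
rewrite eq_uv in settled1; have eq12 := settles_perm settled1 settled2.
have := permP eq1 (pred1 v); rewrite (permP eq2) /= eqxx (permP eq12).
by move/addIn; case: eqVneq.
Qed.

Lemma fire_neq c s v : settles c s -> firable c v -> fire m c v <> c.
Proof.
move=> settled fv eqc.
have [t + /perm_size] := settles_fire settled fv.
by rewrite eqc => /settles_perm/(_ settled)/perm_size /= ->; lia.
Qed.

(** A single firing lowers the rank by exactly one, which leaves no room for an intermediate
    configuration. *)
Lemma fire_cover c d s v : settles c s -> firable c v ->
  reachable m firable c d -> reachable m firable d (fire m c v) -> d <> c ->
  d = fire m c v.
Proof.
move=> settled fv cd dv ndc.
have [t settled1 /perm_size eq_t] := settles_fire settled fv.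
have [t1 settled2 [[//]|lt1]] := settles_reachable cd settled.
have [t2 settled3 [[->]//|lt2]] := settles_reachable dv settled2.
have eq_t2 := perm_size (settles_perm settled1 settled3).
by have := leq_ltn_trans lt2 lt1; rewrite eq_t /= eq_t2 ltnn.
Qed.

(** Both paths leave the same vertices to be fired, so [u, w] and [v, w'] agree as multisets. *)
Lemma fire_diamond c s u v w w' : settles c s -> u != v ->
  firable c u -> firable c v ->
  firable (fire m c u) w -> firable (fire m c v) w' ->
  fire m (fire m c u) w = fire m (fire m c v) w' -> w = v.
Proof.
move=> settled nuv fu fv fw fw' eq_d.
have [s1 settled1 eq1] := settles_fire settled fu.
have [s2 settled2 eq2] := settles_fire settled1 fw.
have [t1 settled3 eq3] := settles_fire settled fv.
have [t2 + eq4] := settles_fire settled3 fw'.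
rewrite -eq_d => /settles_perm/(_ settled2) eq5.
have := permP eq1 (pred1 v).
rewrite (permP eq3) /= (permP eq4) (permP eq2) /= (permP eq5) eqxx (negbTE nuv).
by rewrite add0n addnA => /addIn; case: (eqVneq w v) => //; rewrite addn0.
Qed.

End Settling.

(** * Covers of the configuration space as single firings *)

Definition edge (V : finType) (m : V -> V -> nat) (firable : config V -> V -> bool)
    (P : Type) (f : P -> config V) (p q : P) (v : V) : Prop :=
  firable (f p) v /\ f q = fire m (f p) v.

Definition covers (d : Order.disp_t) (P : porderType d) (p q : P) : Prop :=
  [/\ p <> q, (p <= q)%O & forall r : P, (p <= r)%O -> (r <= q)%O -> r = p \/ r = q].

Section ConfigSpace.

Variables (V : finType) (m : V -> V -> nat) (firable : config V -> V -> bool).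
Hypothesis rule : threshold_rule m firable.
Variables (d : Order.disp_t) (P : porderType d) (c0 : config V) (f : P -> config V).
Hypothesis conv : convergent m firable c0.
Hypothesis f_inj : injective f.
Hypothesis f_reach : forall c, reachable m firable c0 c <-> exists p, f p = c.
Hypothesis f_le : forall p q, (p <= q)%O <-> reachable m firable (f p) (f q).
Local Notation edge := (edge m firable f).

Lemma settles_point p : exists s, settles m firable (f p) s.
Proof.
have [s settled] := convergent_settles conv.
have /settles_reachable := (f_reach (f p)).2 (ex_intro _ p erefl).
by move=> /(_ rule _ settled)[t]; exists t.
Qed.

Lemma edge_exists p v : firable (f p) v -> exists q, edge p q v.
Proof.
move=> fv; suff /f_reach[q fq] : reachable m firable c0 (fire m (f p) v).
  by exists q.
apply: (@rt_trans _ _ _ (f p)); first by apply/f_reach; exists p.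
by apply: rt_step; exists v.
Qed.

Lemma edge_target p q q' v : edge p q v -> edge p q' v -> q = q'.
Proof. by move=> [_ fq] [_ fq']; apply: f_inj; rewrite fq fq'. Qed.

Lemma edge_label p q v v' : edge p q v -> edge p q v' -> v = v'.
Proof.
move=> [fv fq] [fv' fq']; have [s settled] := settles_point p.
by apply: (fire_inj rule settled) => //; rewrite -fq -fq'.
Qed.

Lemma edge_covers p q v : edge p q v -> covers p q.
Proof.
move=> [fv fq]; have [s settled] := settles_point p; split.
- by move=> eq_pq; apply: (fire_neq rule settled fv); rewrite -fq eq_pq.
- by apply/f_le; apply: rt_step; exists v.
move=> r /f_le le_pr /f_le; rewrite fq => le_rq.
have [/f_inj|neq] := EM (f r = f p); first by left.
by right; apply: f_inj; rewrite fq; apply: (fire_cover rule settled).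
Qed.

(** The first firing on a path from [f p] to [f q] reaches a point of the interval other than [p],
    hence [q] itself. *)
Lemma covers_edge p q : covers p q -> exists v, edge p q v.
Proof.
move=> [neq /f_le le_pq cov]; have [s settled] := settles_point p.
move: (clos_rt_rt1n _ _ _ _ le_pq).
move eq_p: (f p) settled => c settled; move eq_q: (f q) => e ce.
case: ce eq_q => {e} [|c' e [v fv ->] cont] eq_q.
  by case: neq; apply: f_inj; rewrite eq_p eq_q.
rewrite -eq_p in fv cont settled.
have [r pr] := edge_exists fv; have [_ fr] := pr.
have [_ le_pr _] := edge_covers pr.
have le_rq : (r <= q)%O by apply/f_le; rewrite fr eq_q; apply: clos_rt1n_rt.
exists v; have [eq_rp|<-//] := cov _ le_pr le_rq.
by case: (fire_neq rule settled fv); rewrite -fr eq_rp.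
Qed.

Lemma edge_diamond p q r u v : u != v -> edge p q u -> edge p r v ->
  exists2 t, edge q t v & edge r t u.
Proof.
move=> nuv [fu fq] [fv fr].
have /edge_exists[t qt] : firable (f q) v.
  by rewrite fq; apply: (firable_persists rule); rewrite // eq_sym.
exists t => //; split; first by rewrite fr; apply: (firable_persists rule).
by case: qt => _ ->; rewrite fq fr (fireC rule).
Qed.

Lemma edge_diamond_label p q r t u v w w' : u != v ->
  edge p q u -> edge p r v -> edge q t w -> edge r t w' -> w = v.
Proof.
move=> nuv [fu fq] [fv fr] [fw ft] [fw' ft']; have [s settled] := settles_point p.
rewrite fq in fw ft; rewrite fr in fw' ft'.
by apply: (fire_diamond rule settled nuv fu fv fw fw'); rewrite -ft -ft'.
Qed.

End ConfigSpace.

(** * Two games with the same configuration space *)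

Section SameSpace.

Variables (d : Order.disp_t) (P : porderType d).
Variables (V1 : finType) (m1 : V1 -> V1 -> nat) (firable1 : config V1 -> V1 -> bool).
Variables (V2 : finType) (m2 : V2 -> V2 -> nat) (firable2 : config V2 -> V2 -> bool).
Hypotheses (rule1 : threshold_rule m1 firable1) (rule2 : threshold_rule m2 firable2).
Variables (c1 : config V1) (f1 : P -> config V1).
Hypotheses (conv1 : convergent m1 firable1 c1) (f1_inj : injective f1).
Hypothesis f1_reach : forall c, reachable m1 firable1 c1 c <-> exists p, f1 p = c.
Hypothesis f1_le : forall p q, (p <= q)%O <-> reachable m1 firable1 (f1 p) (f1 q).
Variables (c2 : config V2) (f2 : P -> config V2).
Hypotheses (conv2 : convergent m2 firable2 c2) (f2_inj : injective f2).
Hypothesis f2_reach : forall c, reachable m2 firable2 c2 c <-> exists p, f2 p = c.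
Hypothesis f2_le : forall p q, (p <= q)%O <-> reachable m2 firable2 (f2 p) (f2 q).
Local Notation edge1 := (edge m1 firable1 f1).
Local Notation edge2 := (edge m2 firable2 f2).

(** Covers depend on the order alone, so firings pass between the games, with labels of their own in
    each. *)
Lemma edge12 p q v : edge1 p q v -> exists w, edge2 p q w.
Proof.
move=> /(edge_covers rule1 conv1 f1_inj f1_reach f1_le).
exact: (covers_edge rule2 conv2 f2_inj f2_reach f2_le).
Qed.

Lemma edge21 p q w : edge2 p q w -> exists v, edge1 p q v.
Proof.
move=> /(edge_covers rule2 conv2 f2_inj f2_reach f2_le).
exact: (covers_edge rule1 conv1 f1_inj f1_reach f1_le).
Qed.

Lemma square_label p q r s u v w : u != v ->
  edge1 p q u -> edge1 p r v -> edge1 q s v -> edge2 p r w -> edge2 q s w.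
Proof.
move=> nuv pq pr qs pr2; have [u' pq2] := edge12 pq.
have [eq_u|nu] := eqVneq u' w.
  move: pq2; rewrite eq_u => /(edge_target f2_inj)/(_ pr2) eq_qr.
  move: nuv; rewrite eq_qr in pq.
  by rewrite (edge_label rule1 conv1 f1_reach pq pr) eqxx.
(* The second game completes a square at some [t]; read in the first game, its side from [q] must be
   labelled [v], which forces [t = s]. *)
have [t qt2 rt2] := edge_diamond rule2 f2_reach nu pq2 pr2.
have [[x qt] [y rt]] := (edge21 qt2, edge21 rt2).
have eq_x := edge_diamond_label rule1 conv1 f1_reach nuv pq pr qt rt.
by rewrite eq_x in qt; rewrite (edge_target f1_inj qs qt).
Qed.

(* Here x has been fired between p and top, the point where the labels A, B, C
   of a, b, c are read off. *)
Lemma label_helps p top qa qb qc x a b c A B C :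
  uniq [:: x; a; b; c] ->
  firable1 (f1 p) b -> firable1 (f1 p) c -> firable1 (fire m1 (f1 p) b) a ->
  (forall w, firable1 (fire m1 (f1 p) c) w -> w \in [:: x; b]) ->
  edge1 p top x -> edge1 top qa a -> edge1 top qb b -> edge1 top qc c ->
  edge2 top qa A -> edge2 top qb B -> edge2 top qc C ->
  firable2 (fire m2 (f2 p) B) A && ~~ firable2 (fire m2 (f2 p) C) A.
Proof.
rewrite /= !inE !negb_or -!andbA andbT => /and5P[nxa nxb nxc nab /andP[nac nbc]].
move=> fb fc fa only px ta tb tc ta2 tb2 tc2.
have exists1 := edge_exists f1_reach; have diamond1 := edge_diamond rule1 f1_reach.
have label1 := edge_label rule1 conv1 f1_reach.
have label2 := edge_label rule2 conv2 f2_reach.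
have [[pb pb1] [pc pc1]] := (exists1 _ _ fb, exists1 _ _ fc).
have [pba pba1] : exists q, edge1 pb q a by apply: exists1; rewrite pb1.2.
have [X px2] := edge12 px.
(* Squares with side [x] from [p] to [top] bring the labels [B] and [C] from [top] down to [p]. *)
have transfer : forall v q r V, x != v -> edge1 p q v -> edge1 top r v ->
  edge2 top r V -> edge2 p q V.
  move=> v q r V nxv pq tr tr2; have [W pq2] := edge12 pq.
  by rewrite (label2 _ _ _ _ tr2 (square_label nxv px pq tr pq2)).
have pb2 := transfer _ _ _ _ nxb pb1 tb tb2.
have pc2 := transfer _ _ _ _ nxc pc1 tc tc2.
have [t tb' pbt1] := diamond1 _ _ _ _ _ nxb px pb1.
have pbqb : edge1 pb qb x by rewrite (edge_target f1_inj tb tb').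
have pbx2 : edge2 pb qb X by apply: (square_label _ pb1 px pbqb); rewrite // eq_sym.
(* No firing of [a] at [p] is given, so the label goes through the edge from [qb] to [s]: one square
   ties it to [pb], another to [top]. *)
have pba2 : edge2 pb pba A.
  have [W pba2] := edge12 pba1.
  have [s qbs1 pbas1] := diamond1 _ _ _ _ _ nxa pbqb pba1.
  have qbs2 := square_label nxa pbqb pba1 qbs1 pba2.
  have nba : b != a by rewrite eq_sym.
  have qbsA := square_label nba tb ta qbs1 ta2.
  by rewrite (label2 _ _ _ _ qbsA qbs2).
(* If [A] were firable after [C], that move would fire [x] or [b] in the first game. Its label would
   then be [X] or [B], and [X = A] or [B = A] identifies two targets with distinct labels in the
   first game. *)
rewrite -pb2.2 pba2.1 -pc2.2; apply/negP => /(edge_exists f2_reach)[q pcq2].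
have [w pcq] := edge21 pcq2.
have : w \in [:: x; b] by apply: only; rewrite -pc1.2 pcq.1.
rewrite !inE => /orP[] /eqP eq_w; rewrite {}eq_w in pcq.
  have pcqX : edge2 pc q X by apply: (square_label _ pc1 px pcq); rewrite // eq_sym.
  have eq_XA := label2 _ _ _ _ pcqX pcq2; rewrite eq_XA in pbx2.
  rewrite (edge_target f2_inj pbx2 pba2) in pbqb.
  by rewrite (label1 _ _ _ _ pbqb pba1) eqxx in nxa.
have ncb : c != b by rewrite eq_sym.
have pcqB := square_label ncb pc1 pb1 pcq pb2.
have eq_BA := label2 _ _ _ _ pcqB pcq2; rewrite eq_BA in tb2.
rewrite (edge_target f2_inj tb2 ta2) in tb.
by rewrite (label1 _ _ _ _ ta tb) eqxx in nab.
Qed.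

End SameSpace.

(** * The cyclic Chip Firing Game *)

(* Vertices 0, 1, 2 are the x_i, 3, 4, 5 are the a_i, and 6 absorbs chips. *)
Definition cyclic_edges : seq (nat * nat) :=
  [:: (0, 3); (1, 4); (2, 5); (4, 3); (5, 4); (3, 5); (3, 6); (4, 6); (5, 6)].

Definition cyclic_mult (u v : 'I_7) : nat := ((val u, val v) \in cyclic_edges).

(** Mirroring configurations by lists lets concrete plays be checked by evaluation. *)
Definition chips (l : seq nat) : config 'I_7 := [ffun v : 'I_7 => nth 0 l v].

Definition fire_chips (l : seq nat) (v : nat) : seq nat :=
  [seq nth 0 l w - (if w == v then count (fun e => e.1 == v) cyclic_edges else 0)
       + ((v, w) \in cyclic_edges) | w <- iota 0 7].

Definition firable_chips (l : seq nat) (v : nat) : bool :=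
  0 < count (fun e => e.1 == v) cyclic_edges <= nth 0 l v.

Lemma deg_cyclic (v : 'I_7) :
  deg cyclic_mult v = count (fun e => e.1 == val v) cyclic_edges.
Proof.
rewrite /deg !big_ord_recl big_ord0.
by case: v; do 7?[case=> [|] //].
Qed.

Lemma fire_chipsE (l : seq nat) (v : 'I_7) :
  fire cyclic_mult (chips l) v = chips (fire_chips l v).
Proof.
apply/ffunP => w; rewrite !ffunE deg_cyclic (nth_map 0) ?size_iota //.
by rewrite nth_iota.
Qed.

Lemma firable_chipsE (l : seq nat) (v : 'I_7) :
  cfg_firable cyclic_mult (chips l) v = firable_chips l v.
Proof. by rewrite /cfg_firable deg_cyclic ffunE. Qed.

Fixpoint legal_chips (l : seq nat) (s : seq 'I_7) : bool :=
  if s is v :: s' then firable_chips l v && legal_chips (fire_chips l v) s'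
  else true.

(** Each [x_i] has out-degree 1 and is ready; each [a_i] has out-degree 2 and lacks one chip, which
    [x_i] or [a_(i+1)] supplies. *)
Definition start : seq nat := [:: 1; 1; 1; 1; 1; 1; 0].

Definition run (s : seq 'I_7) : seq nat :=
  foldl (fun l (v : 'I_7) => fire_chips l v) start s.

Lemma reachable_run (s : seq 'I_7) : legal_chips start s ->
  reachable cyclic_mult (cfg_firable cyclic_mult) (chips start) (chips (run s)).
Proof.
rewrite /run; elim: s start => [|v s IHs] l /=; first by move=> _; apply: rt_refl.
move=> /andP[fv /IHs]; apply: rt_trans; apply: rt_step.
by exists v; rewrite ?firable_chipsE ?fire_chipsE.
Qed.

Definition x0 : 'I_7 := @Ordinal 7 0 isT.
Definition x1 : 'I_7 := @Ordinal 7 1 isT.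
Definition x2 : 'I_7 := @Ordinal 7 2 isT.
Definition a0 : 'I_7 := @Ordinal 7 3 isT.
Definition a1 : 'I_7 := @Ordinal 7 4 isT.
Definition a2 : 'I_7 := @Ordinal 7 5 isT.

Lemma all_ord7 (p : 'I_7 -> bool) :
  [&& p x0, p x1, p x2, p a0, p a1, p a2 & p ord_max] -> forall v, p v.
Proof.
have eq_p (u v : 'I_7) : val u = val v -> p u -> p v by move=> /val_inj ->.
move=> /and5P[p0 p1 p2 p3 /and3P[p4 p5 p6]].
case=> [[|[|[|[|[|[|[|//]]]]]]] lt_k7]; [move: p0 | move: p1 | move: p2 | move: p3
  | move: p4 | move: p5 | move: p6]; exact: eq_p.
Qed.

Lemma convergent_cyclic :
  convergent cyclic_mult (cfg_firable cyclic_mult) (chips start).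
Proof.
(* After one firing each, the [x_i] are empty and the [a_i] hold one chip, below their out-degree
   2. *)
exists (chips (run [:: x0; x1; x2; a0; a1; a2])); first exact: reachable_run.
by apply: all_ord7; rewrite !firable_chipsE.
Qed.

(** * Symmetric multiplicities exclude the cyclic space *)

(** The firings leave [w] with [c w + m u w] and [c w + m v w] chips, and only the first meets the
    threshold. *)
Lemma asm_help_lt (V : finType) (m : V -> V -> nat) (bot : V) (c : config V) (u v w : V) :
  w != u -> w != v ->
  asm_firable m bot (fire m c u) w -> ~~ asm_firable m bot (fire m c v) w ->
  m v w < m u w.
Proof.
move=> nwu nwv; rewrite /asm_firable !fire_other // => /andP[-> le_u].
by rewrite -ltnNge => /leq_trans/(_ le_u); rewrite ltn_add2l.
Qed.

Lemma cyclic_not_ASM (d : Order.disp_t) (P : porderType d) :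
  isom_config_space cyclic_mult (cfg_firable cyclic_mult) P (chips start) -> ~ L_ASM P.
Proof.
move=> [f1 [f1_inj f1_reach f1_le]].
move=> [V [m [bot [c0 [sym conv [f2 [f2_inj f2_reach f2_le]]]]]]].
have rule1 := cfg_threshold_rule cyclic_mult; have rule2 := asm_threshold_rule m bot.
have conv1 := convergent_cyclic.
have transport := edge12 rule1 rule2 conv1 f1_inj f1_reach f1_le conv f2_inj f2_reach f2_le.
(* Once all [x_i] are fired, every [a_i] is firable, so one point serves to read off all three
   labels. *)
have [top f_top] : exists p, f1 p = chips (run [:: x0; x1; x2]).
  by apply/f1_reach/reachable_run.
pose e1 := edge cyclic_mult (cfg_firable cyclic_mult) f1.
pose e2 := edge m (asm_firable m bot) f2.
have top_edge (v : 'I_7) : firable_chips (run [:: x0; x1; x2]) v ->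
    exists q w, e1 top q v /\ e2 top q w.
  move=> fv; have [|q tq] := edge_exists f1_reach (p := top) (v := v).
    by rewrite f_top firable_chipsE.
  by have [w tq2] := transport _ _ _ tq; exists q, w.
have [qa0 [A0 [t0 t0']]] := top_edge a0 isT.
have [qa1 [A1 [t1 t1']]] := top_edge a1 isT.
have [qa2 [A2 [t2 t2']]] := top_edge a2 isT.
(* Needed for the side conditions of [asm_help_lt]; equal labels would lead to the same target. *)
have neq u v qu qv U W : u != v ->
    e1 top qu u -> e1 top qv v -> e2 top qu U -> e2 top qv W -> U != W.
  move=> nuv tu tv tu2 tv2; apply: contraNneq nuv => eq_UW; rewrite eq_UW in tu2.
  rewrite (edge_target f2_inj tu2 tv2) in tu.
  by rewrite (edge_label rule1 conv1 f1_reach tu tv).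
(* In each use [s] fires the two other [x_j], and [x] then leads to [top]; [eq_top] compares chip
   lists, so the order of firing is immaterial. *)
have lt (s : seq 'I_7) (x a b c : 'I_7) qa qb qc A B C :
    uniq [:: x; a; b; c] ->
    run (rcons s x) = run [:: x0; x1; x2] ->
    [&& firable_chips (run s) x, firable_chips (run s) b, firable_chips (run s) c
      & firable_chips (run (rcons s b)) a] ->
    legal_chips start s ->
    (forall w : 'I_7, firable_chips (run (rcons s c)) w ==> (w \in [:: x; b])) ->
    e1 top qa a -> e1 top qb b -> e1 top qc c ->
    e2 top qa A -> e2 top qb B -> e2 top qc C -> m C A < m B A.
  move=> distinct eq_top /and4P[fx fb fc fa] legal_s only ta tb tc ta2 tb2 tc2.
  have [p fp] : exists p, f1 p = chips (run s) by apply/f1_reach/reachable_run.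
  have run_rcons (v : 'I_7) : fire cyclic_mult (f1 p) v = chips (run (rcons s v)).
    by rewrite fp fire_chipsE /run foldl_rcons.
  have px : e1 p top x.
    by split; rewrite ?run_rcons ?f_top ?eq_top // fp firable_chipsE.
  have /andP[] : asm_firable m bot (fire m (f2 p) B) A
              && ~~ asm_firable m bot (fire m (f2 p) C) A.
    apply: (label_helps rule1 rule2 conv1 f1_inj f1_reach f1_le conv f2_inj f2_reach f2_le
      distinct _ _ _ _ px ta tb tc ta2 tb2 tc2); rewrite ?run_rcons ?fp ?firable_chipsE //.
    by move=> w; rewrite firable_chipsE; apply/implyP/only.
  move: distinct; rewrite /= !inE !negb_or => /and4P[_ /andP[nab nac] _ _].
  by apply: asm_help_lt; [apply: neq nab ta tb ta2 tb2 | apply: neq nac ta tc ta2 tc2].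
have lt0 : m A2 A0 < m A1 A0.
  by apply: (lt [:: x1; x2] x0 a0 a1 a2) t0 t1 t2 t0' t1' t2' => //; apply: all_ord7.
have lt1 : m A0 A1 < m A2 A1.
  by apply: (lt [:: x2; x0] x1 a1 a2 a0) t1 t2 t0 t1' t2' t0' => //; apply: all_ord7.
have lt2 : m A1 A2 < m A0 A2.
  by apply: (lt [:: x0; x1] x2 a2 a0 a1) t2 t0 t1 t2' t0' t1' => //; apply: all_ord7.
(* Symmetry turns the inequalities into [m A0 A2 < m A0 A1 < m A1 A2 < m A0 A2]. *)
by have := sym A0 A1; have := sym A1 A2; have := sym A2 A0; lia.
Qed.

(** * The cyclic configuration space as a poset *)

Definition cyclic_space : Type := {c : config 'I_7 |
  `[< reachable cyclic_mult (cfg_firable cyclic_mult) (chips start) c >]}.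

HB.instance Definition _ := Choice.on cyclic_space.

Definition cyclic_le (p q : cyclic_space) : bool :=
  `[< reachable cyclic_mult (cfg_firable cyclic_mult) (val p) (val q) >].

Lemma cyclic_le_refl : reflexive cyclic_le.
Proof. by move=> p; apply/asboolP; apply: rt_refl. Qed.

Lemma cyclic_le_trans : transitive cyclic_le.
Proof. by move=> q p r /asboolP pq /asboolP qr; apply/asboolP; apply: rt_trans pq qr. Qed.

Lemma cyclic_le_anti : antisymmetric cyclic_le.
Proof.
move=> p q /andP[/asboolP pq /asboolP qp]; apply: val_inj.
have rule := cfg_threshold_rule cyclic_mult.
have [s settled] := convergent_settles convergent_cyclic.
have [t settled' _] := settles_reachable rule (asboolW (valP p)) settled.
by apply: (reachable_anti rule settled' pq qp).
Qed.

Fact cyclic_display : Order.disp_t. Proof. exact: Order.Disp tt tt. Qed.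

HB.instance Definition _ := Order.Le_isPOrder.Build cyclic_display cyclic_space
  cyclic_le_refl cyclic_le_anti cyclic_le_trans.

Lemma cyclic_isom : isom_config_space cyclic_mult (cfg_firable cyclic_mult)
  cyclic_space (chips start).
Proof.
exists val; split; first exact: val_inj.
- move=> c; split=> [reach_c|[p <-]]; last exact: asboolW (valP p).
  by exists (exist _ c (asboolT reach_c)).
- by move=> p q; split=> /asboolP.
Qed.

(** * From sandpiles to chip firing *)

Lemma ASM_CFG (d : Order.disp_t) (P : porderType d) : L_ASM P -> L_CFG P.
Proof.
move=> [V [m [bot [c0 [_ conv isom]]]]].
pose m' u v := if u == bot then 0 else m u v.
(* An isolated vertex can always be fired in the ASM, but never in the CFG. *)
have deg_gt0 v : v != bot -> 0 < deg m v.
  move=> nv; rewrite lt0n; apply/eqP => deg0; case: conv => c _ /(_ v).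
  by rewrite /asm_firable nv deg0.
have deg' v : v != bot -> deg m' v = deg m v.
  by move=> /negbTE nv; apply: eq_bigr => w _; rewrite /m' nv.
have eq_firable : asm_firable m bot = cfg_firable m'.
  apply/funext => c; apply/funext => v; rewrite /asm_firable /cfg_firable.
  case: eqVneq => [->|nv] /=; last by rewrite deg' ?deg_gt0.
  by rewrite /deg big1 // => w _; rewrite /m' eqxx.
have eq_step : step m (asm_firable m bot) = step m' (cfg_firable m').
  rewrite -eq_firable; apply/funext => c; apply/funext => c'; apply/propext.
  (* Only legal moves are compared, since firing the sink itself may differ under [m] and [m']. *)
  have eq_fire v : asm_firable m bot c v -> fire m c v = fire m' c v.
    move=> /andP[nv _]; apply/ffunP => w.
    by rewrite !ffunE deg' // /m' (negbTE nv).
  by split=> -[v fv ->]; exists v; rewrite ?eq_fire.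
exists V, m', c0; move: conv isom.
by rewrite /convergent /isom_config_space /reachable eq_step eq_firable.
Qed.

Theorem theorem6 :
  (forall (d : Order.disp_t) (P : porderType d), L_ASM P -> L_CFG P) /\
  (exists (d : Order.disp_t) (P : porderType d), L_CFG P /\ ~ L_ASM P).
Proof.
split; first exact: ASM_CFG.
exists cyclic_display, cyclic_space; split; last exact: cyclic_not_ASM cyclic_isom.
exists 'I_7, cyclic_mult, (chips start).
by split; [apply: convergent_cyclic | apply: cyclic_isom].
Qed.
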